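(* For any dataset, with set of training examples $X=\{1,\dots,m\}$ and feature matrix $\mathbf M\in[-1,1]^{m\times N}$, there exists a partition of $X$ into a (possibly empty) set $Z$ (the zero-loss set) and a (possibly empty) set $F=X\setminus Z$ (the finite-margin set) such that the following hold simultaneously: (1) For some positive constant $\gamma>0$, there exists some vector $\eta^\dagger\in\mathbb R^N$ with unit $\ell_1$-norm, $\|\eta^\dagger\|_1=1$, that attains at least $\gamma$ margin on each example in $Z$ and exactly zero margin on each example in $F$: $(\mathbf M\eta^\dagger)_i\ge\gamma$ for all $i\in Z$, and $(\mathbf M\eta^\dagger)_i=0$ for all $i\in F$. (2) The optimal loss considering only examples within $F$ is achieved by some finite combination $\eta^*\in\mathbb R^N$, i.e. $\sum_{i\in F}e^{-(\mathbf M\eta^* )_i}=\inf_{\lambda\in\mathbb R^N}\sum_{i\in F}e^{-(\mathbf M\lambda)_i}$. (3) There is a constant $\mu_{\max}<\infty$ such that for any combination $\eta\in\mathbb R^N$ with bounded loss on the finite-margin set, $\sum_{i\in F}e^{-(\mathbf M\eta)_i}\le m$, the margin $(\mathbf M\eta)_i$ for any example $i$ in $F$ lies in the bounded interval $[-\ln m,\mu_{\max}]$.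
   Context: A dataset consists of $m$ labeled training examples $(x_1,y_1),\dots,(x_m,y_m)$ with labels $y_i\in\{-1,+1\}$, together with a finite set of $N$ weak hypotheses $h_1,\dots,h_N$ taking values in $[-1,+1]$ (in the basic setting, in $\{-1,+1\}$). Its feature matrix $\mathbf M\in[-1,1]^{m\times N}$ has entries $M_{ij}=y_i h_j(x_i)$, with rows indexed by training examples and columns by weak hypotheses; example $i$ is identified with its index. A combination is a vector $\lambda\in\mathbb R^N$ of weights on the weak hypotheses. The margin of $\lambda$ on example $i$ is $(\mathbf M\lambda)_i$, the loss of $\lambda$ on example $i$ is $e^{-(\mathbf M\lambda)_i}$, and the loss on a set of examples is the sum of the losses on its members (an empty sum is $0$).
   Formalization: The unit norm of η† in (1) is required only when Z is nonempty or Mv=0 for some nonzero v; otherwise (Z empty, M injective) zero margin on every example forces η†=0, so the claim as stated fails, e.g. for M=(1,-1)^T. *)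

(* Defs.v *)
From mathcomp Require Import all_boot all_order all_algebra.
From mathcomp Require Import all_classical all_reals.
From mathcomp.analysis Require Import sequences exp.

Set Implicit Arguments.
Unset Strict Implicit.
Unset Printing Implicit Defensive.

Import Order.TTheory GRing.Theory Num.Theory.
Local Open Scope ring_scope.

(* [m] labeled examples from an instance space [T] and [N] weak hypotheses;
   repeated examples or hypotheses are allowed, as are [m = 0] and [N = 0]. *)
Record dataset (R : realType) (T : Type) (m N : nat) := Dataset {
  example : 'I_m -> T;
  label : 'I_m -> R;
  hypothesis : 'I_N -> T -> R;
  label_pm1 : forall i, label i = -1 \/ label i = 1;
  hypothesis_bounded : forall j x, -1 <= hypothesis j x <= 1
}.

Section Margins.
Variables (R : realType) (m N : nat).

Definition feature_mx (T : Type) (D : dataset R T m N) : 'M[R]_(m, N) :=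
  \matrix_(i, j) (label D i * hypothesis D j (example D i)).

Definition margin (M : 'M[R]_(m, N)) (eta : 'cV[R]_N) (i : 'I_m) : R :=
  (M *m eta) i 0.

Definition loss (M : 'M[R]_(m, N)) (A : {set 'I_m}) (eta : 'cV[R]_N) : R :=
  \sum_(i in A) expR (- margin M eta i).

(* The library norm on matrices is the sup norm. *)
Definition l1norm (eta : 'cV[R]_N) : R := \sum_j `|eta j 0|.

End Margins.

(* Main.v *)
Require Import Defs.
From mathcomp Require Import all_boot all_order all_algebra.
From mathcomp Require Import all_classical all_reals.
From mathcomp.analysis Require Import topology normedtype derive.
From mathcomp.analysis Require Import sequences exp.

Set Implicit Arguments.
Unset Strict Implicit.
Unset Printing Implicit Defensive.

Import Order.TTheory GRing.Theory Num.Theory.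
Import numFieldNormedType.Exports.
Local Open Scope ring_scope.

(** Call a combination nonnegative if all its margins are.  The sum of finitely
    many nonnegative combinations has a positive margin wherever one of them
    does, so some nonnegative [eta0] has positive margins on the largest
    possible set of examples ([maximal_nonneg_direction]).  Let [Z] be that set
    and [F] its complement; normalizing [eta0] gives the direction that
    separates them.

    On [F] only the zero vector is both a vector of margins and nonnegative:
    given a combination with nonnegative margins on [F], adding a large multiple
    of [eta0] repairs its negative margins on [Z] and changes nothing on [F], and
    the resulting nonnegative combination vanishes on [F] by maximality
    ([restrict_mx_pointed]).

    The margin vectors on [F] form a linear subspace of a finite-dimensional
    space.  A subspace that meets the nonnegative orthant only in 0 satisfies, by
    compactness of its unit sphere, an inequality bounding the whole l1 norm by
    the negative part ([pointed_row_space_coercive]); so in it a lower bound on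
    the entries entails an upper bound ([pointed_row_space_bound]).  A loss at
    most [m] bounds the margins on [F] below by [- ln m], hence also above.  As
    for the optimal loss, the combinations of loss at most [m] may form an
    unbounded set, but their margin vectors lie in a compact piece of the
    subspace, on which the loss has a minimum; the zero combination has loss at
    most [m], so combinations of larger loss do not matter. *)

(** * Infima and the l1 norm *)

Lemma inf_range_min (R : realType) (T : Type) (f : T -> R) (x : T) :
  (forall y, f x <= f y) -> inf (range f) = f x.
Proof.
move=> fx_min; have lb_fx : lbound (range f) (f x) by move=> _ [y _ <-].
apply/eqP; rewrite eq_le; apply/andP; split.
  by apply: ge_inf; [exists (f x) | exists x].
by apply: lb_le_inf => //; exists (f x); exists x.
Qed.

Lemma entry_le_l1norm (R : realType) (N : nat) (eta : 'cV[R]_N) j :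
  `|eta j 0| <= l1norm eta.
Proof. by rewrite /l1norm (bigD1 j)//= lerDl sumr_ge0. Qed.

Lemma l1norm_tr (R : realType) (N : nat) (w : 'rV[R]_N) :
  l1norm w^T = \sum_i `|w 0 i|.
Proof. by apply: eq_bigr => i _; rewrite mxE. Qed.

Lemma l1norm_normalize (R : realType) (N : nat) (eta : 'cV[R]_N) : eta != 0 ->
  0 < l1norm eta /\ l1norm ((l1norm eta)^-1 *: eta) = 1.
Proof.
move=> eta0; have s_gt0 : 0 < l1norm eta.
  rewrite lt_neqAle sumr_ge0// andbT eq_sym; apply: contraNneq eta0 => s0.
  by apply/eqP/colP => j; apply/eqP; rewrite mxE -normr_le0 -s0 entry_le_l1norm.
split=> //; rewrite {1}/l1norm.
under eq_bigr do rewrite mxE normrM gtr0_norm ?invr_gt0//.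
by rewrite -mulr_sumr mulVf// gt_eqF.
Qed.

(** * Compactness in a row space *)

Section RowSpace.
Local Open Scope classical_set_scope.
Variables (R : realType) (n m : nat).
Implicit Types (w : 'rV[R]_m) (B : 'M[R]_(n, m)).

Lemma continuous_sum_coord (P : pred 'I_m) (g : 'I_m -> R -> R) :
  (forall i, continuous (g i)) ->
  continuous (fun w => \sum_(i | P i) g i (w 0 i)).
Proof.
move=> g_cont; apply: continuous_big => [|i _ w]; first exact: add_continuous.
apply: (@continuous_comp _ _ _ (fun w => w 0 i) (g i)).
  exact: coord_continuous.
exact: g_cont.
Qed.

Lemma closed_sum_coord_eq (g : 'I_m -> R -> R) (y : R) :
  (forall i, continuous (g i)) ->
  closed [set w : 'rV[R]_m | \sum_i g i (w 0 i) = y].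
Proof.
move=> /(@continuous_sum_coord xpredT)/continuous_closedP.
by move=> /(_ [set y]); apply; exact: closed_eq.
Qed.

Lemma closed_row_space B : closed [set w : 'rV[R]_m | (w <= B)%MS].
Proof.
have -> : [set w : 'rV[R]_m | (w <= B)%MS] = 
    \bigcap_(j in [set: 'I_m]) [set w : 'rV[R]_m | \sum_i w 0 i * cokermx B i j = 0].
  apply/seteqP; split=> w /=; rewrite submxE.
    by move=> /eqP wB0 j _ /=; have := congr1 (fun A : 'rV_m => A 0 j) wB0;
      rewrite !mxE.
  by move=> wB0; apply/eqP/rowP => j; rewrite !mxE; exact: wB0.
apply: closed_bigI => j _.
apply: (@closed_sum_coord_eq (fun i x => x * cokermx B i j)) => i.
exact: mulrr_continuous.
Qed.

Lemma compact_row_space_box B (a b : R) :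
  compact [set w : 'rV[R]_m | (w <= B)%MS /\ forall i, a <= w 0 i <= b].
Proof.
rewrite (_ : mkset _ = [set w : 'rV[R]_m | forall i, `[a, b] (w ord0 i)] `&`
    [set w : 'rV[R]_m | (w <= B)%MS]); last first.
  apply/seteqP; split=> w [].
    by move=> wB w_box; split=> // i; rewrite /= in_itv; exact: w_box.
  by move=> w_box wB; split=> // i; have := w_box i; rewrite /= in_itv.
apply: compact_closedI; last exact: closed_row_space.
by apply: (@rV_compact _ _ (fun=> `[a, b])) => _; exact: segment_compact.
Qed.

(** The right-hand side is twice the l1 norm of the negative part of [w].  It is
    continuous and positive on the l1 unit sphere of the row space, which is
    compact, so its minimum there serves as [d]; both sides being homogeneous,
    the inequality extends to the whole row space. *)
Lemma pointed_row_space_coercive B :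
  (forall w, (w <= B)%MS -> (forall i, 0 <= w 0 i) -> w = 0) ->
  exists2 d : R, 0 < d & forall w, (w <= B)%MS ->
    d * (\sum_i `|w 0 i|) <= \sum_i (`|w 0 i| - w 0 i).
Proof.
move=> B_pointed.
pose S := [set w : 'rV[R]_m | (w <= B)%MS /\ \sum_i `|w 0 i| = 1].
pose neg w := \sum_i (`|w 0 i| - w 0 i).
have abs_le w i : `|w 0 i| <= \sum_k `|w 0 k|.
  by have := entry_le_l1norm w^T i; rewrite l1norm_tr mxE.
have S_compact : compact S.
  have -> : S = ([set w : 'rV[R]_m | (w <= B)%MS /\ forall i, -1 <= w 0 i <= 1] `&`
      [set w : 'rV[R]_m | \sum_i `|w 0 i| = 1])%classic.
    apply/seteqP; split=> w; last by move=> [[]].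
    by move=> [wB w1]; split=> //; split=> // i; rewrite -ler_norml -w1.
  apply: compact_closedI; first exact: compact_row_space_box.
  by apply: (@closed_sum_coord_eq (fun _ x => `|x|)) => i; exact: norm_continuous.
have neg_cont : continuous neg.
  apply: (@continuous_sum_coord _ (fun _ x => `|x| - x)) => i x.
  by apply: continuousB; [exact: norm_continuous | exact: cvg_id].
have normalize w : (w <= B)%MS -> w != 0 ->
    0 < \sum_i `|w 0 i| /\ S ((\sum_i `|w 0 i|)^-1 *: w).
  rewrite -trmx_eq0 => wB /l1norm_normalize; rewrite -linearZ /= !l1norm_tr.
  by move=> [s_gt0 s1]; split=> //; split=> //; exact: scalemx_sub.
(* The sphere is empty exactly when the row space is 0. *)
have [S0|/set0P S_neq0] := eqVneq S set0.
  exists 1 => // w wB; have [->|w0] := eqVneq w 0.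
    by rewrite !big1 ?mulr0// => i _; rewrite mxE normr0 ?subr0.
  by have [_] := normalize w wB w0; rewrite S0.
have [z Sz z_min] := compact_EVT_min S_neq0 S_compact (continuous_subspaceT neg_cont).
have {Sz} [zB z1] : S z by rewrite inE in Sz.
have term_ge0 i : 0 <= `|z 0 i| - z 0 i by rewrite subr_ge0 ler_norm.
have neg_gt0 : 0 < neg z.
  rewrite lt_neqAle sumr_ge0// andbT; apply/eqP => neg0.
  (* A vector without negative part is nonnegative, hence 0, off the sphere. *)
  have z0 : z = 0.
    apply: B_pointed => // i.
    have /eqP := @psumr_eq0P _ _ xpredT _ (fun i _ => term_ge0 i) (esym neg0) i isT.
    by rewrite subr_eq0 => /eqP <-.
  move: z1; rewrite z0 big1 => [/eqP|i _]; last by rewrite mxE normr0.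
  by rewrite eq_sym oner_eq0.
exists (neg z) => // w wB; have [->|w0] := eqVneq w 0.
  by rewrite !big1 ?mulr0// => i _; rewrite mxE normr0 ?subr0.
have [s_gt0 Sw] := normalize w wB w0.
have := z_min _ (mem_set Sw); rewrite {2}/neg.
under eq_bigr do rewrite mxE normrM gtr0_norm ?invr_gt0// -mulrBr.
by rewrite -mulr_sumr ler_pdivlMl// mulrC.
Qed.

(** Each of the [m] entries contributes at most [2 * b] to the right-hand side of
    the coercivity inequality. *)
Lemma pointed_row_space_bound B :
  (forall w, (w <= B)%MS -> (forall i, 0 <= w 0 i) -> w = 0) ->
  exists2 c : R, 0 <= c & forall w b, (w <= B)%MS -> 0 <= b ->
    (forall i, - b <= w 0 i) -> forall i, w 0 i <= c * b.
Proof.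
move=> /pointed_row_space_coercive[d d_gt0 d_le].
exists (d^-1 * (2 * m%:R)) => [|w b wB b_ge0 w_ge i].
  by rewrite mulr_ge0 ?mulr_ge0 ?invr_ge0 ?(ltW d_gt0).
apply: le_trans (ler_norm _) _.
have := entry_le_l1norm w^T i; rewrite l1norm_tr mxE => /le_trans; apply.
rewrite -mulrA ler_pdivlMl// (le_trans (d_le w wB))//.
have -> : 2 * m%:R * b = \sum_(k < m) (2 * b).
  by rewrite sumr_const card_ord -[RHS]mulr_natr mulrAC.
apply: ler_sum => k _; have := w_ge k; have [w0|w0] := ger0P (w 0 k) => wk.
  by rewrite subrr mulr_ge0.
by rewrite -opprD lerNl mulr2n mulrDl mul1r opprD lerD.
Qed.

End RowSpace.

(** * Margins and the finite-margin set *)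

Section Margins.
Variables (R : realType) (m N : nat) (M : 'M[R]_(m, N)).
Implicit Types (eta : 'cV[R]_N) (F : {set 'I_m}) (i : 'I_m).

Lemma margin0 i : margin M 0 i = 0.
Proof. by rewrite /margin mulmx0 mxE. Qed.

Lemma marginD eta eta' i : margin M (eta + eta') i = margin M eta i + margin M eta' i.
Proof. by rewrite /margin mulmxDr mxE. Qed.

Lemma marginZ a eta i : margin M (a *: eta) i = a * margin M eta i.
Proof. by rewrite /margin -scalemxAr mxE. Qed.

Lemma margin_sum (I : Type) (r : seq I) (eta : I -> 'cV[R]_N) i :
  margin M (\sum_(k <- r) eta k) i = \sum_(k <- r) margin M (eta k) i.
Proof. by rewrite /margin mulmx_sumr summxE. Qed.

(** For each example choose a nonnegative combination with nonzero margin there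
    if one exists, and sum the choices: no cancellation occurs. *)
Lemma maximal_nonneg_direction :
  exists2 eta0, forall i, 0 <= margin M eta0 i &
    forall eta, (forall i, 0 <= margin M eta i) ->
    forall i, margin M eta0 i = 0 -> margin M eta i = 0.
Proof.
have /choice[e eP] i : exists eta0, (forall k, 0 <= margin M eta0 k) /\
    forall eta, (forall k, 0 <= margin M eta k) ->
      margin M eta0 i = 0 -> margin M eta i = 0.
  have [[eta [eta_ge0 eta_neq0]]|no_eta] := pselect
      (exists eta, (forall k, 0 <= margin M eta k) /\ margin M eta i <> 0).
    by exists eta; split.
  exists 0; split=> [k|eta eta_ge0 _]; first by rewrite margin0.
  by apply: contrapT => eta_neq0; apply: no_eta; exists eta.
exists (\sum_i e i) => [i|eta eta_ge0 i].
  by rewrite margin_sum sumr_ge0// => k _; have [] := eP k.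
rewrite margin_sum => sum0; have [_] := eP i; apply=> //.
by apply: (psumr_eq0P _ sum0) => // k _; have [] := eP k.
Qed.

(** The row space of this matrix is the space of margin vectors on [F], extended
    by 0 outside [F]: keeping the width [m] avoids reindexing [F], and the added
    zero entries respect any box around 0.  It is transposed because
    [submx] and [rV_compact] speak of row vectors. *)
Definition restrict_mx F : 'M[R]_(N, m) :=
  \matrix_(j, i) (M i j *+ (i \in F)).

Lemma restrict_mxE F eta i :
  (eta^T *m restrict_mx F) 0 i = margin M eta i *+ (i \in F).
Proof.
rewrite /margin !mxE -sumrMnl; apply: eq_bigr => j _.
by rewrite !mxE mulrC mulrnAl.
Qed.

(** Adding [t *: eta0] with [t] large makes every margin of [eta] nonnegative
    without changing those on [F]; maximality of [eta0] then kills them. *)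
Lemma restrict_mx_pointed eta0 (F := [set i | margin M eta0 i == 0]%SET) :
  (forall i, 0 <= margin M eta0 i) ->
  (forall eta, (forall i, 0 <= margin M eta i) ->
    forall i, margin M eta0 i = 0 -> margin M eta i = 0) ->
  forall w : 'rV[R]_m, (w <= restrict_mx F)%MS -> (forall i, 0 <= w 0 i) -> w = 0.
Proof.
move=> eta0_ge0 eta0_max _ /submxP[u ->]; rewrite -[u]trmxK.
set eta := u^T => w_ge0; apply/rowP => i; rewrite restrict_mxE mxE.
have [iF|//] := boolP (i \in F).
(* For [k] in [F] the quotient is by 0, hence 0 by convention. *)
pose t := \sum_k `|margin M eta k| / margin M eta0 k.
have t_term_ge0 k : 0 <= `|margin M eta k| / margin M eta0 k.
  by rewrite divr_ge0.
have etat_ge0 k : 0 <= margin M (eta + t *: eta0) k.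
  rewrite marginD marginZ; have := w_ge0 k; rewrite restrict_mxE inE.
  have [->|e0] := eqVneq; first by rewrite mulr0 addr0.
  have e_gt0 : 0 < margin M eta0 k by rewrite lt_neqAle eq_sym e0 eta0_ge0.
  move=> _; have : `|margin M eta k| <= t * margin M eta0 k.
    by rewrite -ler_pdivrMr// /t (bigD1 k)//= lerDl sumr_ge0.
  by rewrite -lerBlDl sub0r; apply: le_trans; rewrite -normrN ler_norm.
have e0 : margin M eta0 i = 0 by move: iF; rewrite inE => /eqP.
by have := eta0_max _ etat_ge0 i e0; rewrite marginD marginZ e0 mulr0 addr0.
Qed.

(** A single term of the loss is at most the whole sum. *)
Lemma margin_ge_of_loss F eta (b : R) i : 0 < b -> i \in F ->
  loss M F eta <= b -> - ln b <= margin M eta i.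
Proof.
move=> b_gt0 iF loss_le; rewrite lerNl -ler_expR lnK//.
apply: le_trans loss_le; rewrite /loss (bigD1 i)//= lerDl.
by rewrite sumr_ge0// => k _; exact: expR_ge0.
Qed.

Lemma loss0_le F : loss M F 0 <= m%:R.
Proof.
rewrite /loss; under eq_bigr do rewrite margin0 oppr0 expR0.
by rewrite sumr_const ler_nat -[leqRHS]card_ord max_card.
Qed.

End Margins.

Theorem lemma15 (R : realType) (T : Type) (m N : nat) (D : dataset R T m N) :
  let M := feature_mx D in
  exists Z F : {set 'I_m},
    [/\ F = ~: Z,
        exists gamma : R, 0 < gamma /\
          exists eta_dag : 'cV[R]_N,
            [/\ Z != finset.set0 \/
                  (exists2 v : 'cV[R]_N, v != 0 & M *m v = 0) ->
                  l1norm eta_dag = 1,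
                forall i, i \in Z -> gamma <= margin M eta_dag i
              & forall i, i \in F -> margin M eta_dag i = 0],
        exists eta_star : 'cV[R]_N,
          loss M F eta_star = inf (range (loss M F))
      & exists mu_max : R, forall eta : 'cV[R]_N,
          loss M F eta <= m%:R ->
          forall i, i \in F -> - ln m%:R <= margin M eta i <= mu_max].
Proof.
move=> M; have [eta0 eta0_ge0 eta0_max] := maximal_nonneg_direction M.
pose F := [set i | margin M eta0 i == 0]%SET; exists (~: F)%SET, F.
have ZP i : (i \in ~: F) = (0 < margin M eta0 i).
  by rewrite !inE lt_neqAle eq_sym eta0_ge0 andbT.
have FP i : i \in F -> margin M eta0 i = 0 by rewrite inE => /eqP.
have m_pos (i : 'I_m) : 0 < m%:R :> R by rewrite ltr0n (leq_ltn_trans _ (ltn_ord i)).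
(* For [m = 0] this rests on the convention that [ln 0] is 0. *)
have ln_m_ge0 : 0 <= ln m%:R :> R.
  by case: (posnP m) => [->|m_gt0]; [rewrite ln0 | rewrite ln_ge0// ler1n].
have [c c_ge0 c_bound] :=
  pointed_row_space_bound (restrict_mx_pointed eta0_ge0 eta0_max).
have bounded eta : loss M F eta <= m%:R ->
    forall i, - ln m%:R <= (eta^T *m restrict_mx M F) 0 i <= c * ln m%:R.
  move=> loss_le; have w_ge i : - ln m%:R <= (eta^T *m restrict_mx M F) 0 i.
    rewrite restrict_mxE; case: (boolP (i \in F)) => [iF|_] /=; last by rewrite oppr_le0.
    exact: margin_ge_of_loss (m_pos i) iF loss_le.
  by move=> i; rewrite w_ge c_bound// submxMl.
split.
- by rewrite finset.setCK.
(* If [eta0] has no positive margin it may be 0; then a unit vector can only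
   come from the kernel of [M], when that is nontrivial. *)
- have [v [v_neq0 v_pos v_zero]] : exists v : 'cV[R]_N,
      [/\ (~: F)%SET != finset.set0 \/
            (exists2 v : 'cV[R]_N, v != 0 & M *m v = 0) -> v != 0,
          forall i, i \in (~: F)%SET -> 0 < margin M v i
        & forall i, i \in F -> margin M v i = 0].
    have [[v v_neq0 Mv0]|no_v] := pselect
        (exists2 v : 'cV[R]_N, v != 0 & M *m v = 0); last first.
      exists eta0; split=> [[/finset.set0Pn[i]|/no_v//]|i|//]; rewrite ZP//.
      by apply: contraTneq => ->; rewrite margin0 ltxx.
    have [Z0|/finset.set0Pn[i iZ]] := eqVneq (~: F)%SET finset.set0.
      exists v; split=> // i; first by rewrite Z0 inE.
      by rewrite /margin Mv0 mxE.
    exists eta0; split=> [_|k|//]; last by rewrite ZP.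
    by move: iZ; rewrite ZP; apply: contraTneq => ->; rewrite margin0 ltxx.
  (* If [v] is 0, then [Z] is empty and [M] injective, so any factor does. *)
  pose s := if v == 0 then 1 else (l1norm v)^-1.
  have s_gt0 : 0 < s.
    rewrite /s; case: eqP => // /eqP v0.
    by rewrite invr_gt0; have [] := l1norm_normalize v0.
  (* The default 1 keeps the minimum positive when [Z] is empty. *)
  exists (\big[Order.min/1]_(i in (~: F)%SET) margin M (s *: v) i); split.
    apply: (big_ind (fun x : R => 0 < x)) => // [x y x0 y0|i iZ].
      by rewrite lt_min x0.
    by rewrite marginZ mulr_gt0// v_pos.
  exists (s *: v); split=> [/v_neq0 v0|i iZ|i iF].
  + by rewrite /s (negbTE v0); have [] := l1norm_normalize v0.
  + by apply: (bigmin_le_cond _ (fun k => margin M (s *: v) k)).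
  + by rewrite marginZ v_zero// mulr0.
(* The minimum is taken over margin vectors, which stay in a compact set,
   and pulled back to a combination at the end. *)
- pose K := [set w : 'rV[R]_m | (w <= restrict_mx M F)%MS /\
      forall i, - ln m%:R <= w 0 i <= c * ln m%:R]%classic.
  pose f (w : 'rV[R]_m) := \sum_(i in F) expR (- w 0 i).
  have lossE eta : loss M F eta = f (eta^T *m restrict_mx M F).
    by apply: eq_bigr => i iF; rewrite restrict_mxE iF.
  have f_cont : continuous f.
    apply: (@continuous_sum_coord _ _ _ (fun _ x => expR (- x))) => i x.
    by apply: continuous_comp; [exact: oppr_continuous | exact: continuous_expR].
  have inK eta : loss M F eta <= m%:R -> K (eta^T *m restrict_mx M F).
    by move=> /bounded; split=> //; exact: submxMl.
  have K_neq0 : (K !=set0)%classic.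
    by eexists; exact: inK (loss0_le M F).
  have [w Kw w_min] := compact_EVT_min K_neq0
    (@compact_row_space_box _ _ _ _ _ _) (continuous_subspaceT f_cont).
  have [/submxP[u w_def] _] : K w by rewrite inE in Kw.
  exists u^T; apply/esym/inf_range_min => eta.
  rewrite [leLHS]lossE trmxK -w_def.
  have [/inK/mem_set/w_min|m_lt] := leP (loss M F eta) m%:R.
    by rewrite lossE.
  apply: le_trans (ltW m_lt); apply: le_trans (loss0_le M F).
  by rewrite lossE; apply/w_min/mem_set/inK/loss0_le.
- exists (c * ln m%:R) => eta /bounded w_bounds i iF.
  by have := w_bounds i; rewrite restrict_mxE iF.
Qed.
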